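(* For $n\ge 3$, let $v_n=34\cdots n12\in\mathfrak{S}_n$ (one-line notation), with reduced expression $\underline{v_n}=s_2s_1s_3s_2s_4s_3\cdots s_{n-1}s_{n-2}$. Then $$\tilde{R}_{e,v_n}(t)=\tilde{\mathcal{R}}_{e,\underline{v_n}}(t)=t^2\mathcal{F}_{n-3}(t)=t^{n-2}F_{n-2}(t).$$
   Context: $\mathfrak{S}_n$ has Coxeter generators $s_i=(i,i+1)$. Fibonacci polynomials: $F_0=1$, $F_1(t)=t$, $F_m(t)=tF_{m-1}(t)+F_{m-2}(t)$. Modified Fibonacci polynomials: $\mathcal{F}_m(t)=t^{m-1}F_{m+1}(t)$ (so $\mathcal{F}_0=1$). Hecke algebra: generated over $\mathbb{Z}[t,t^{-1}]$ by $H_s$ with $H_s^2=1+(t^{-1}-t)H_s$ and braid relations; $H_v=H_{s_1}\cdots H_{s_k}$ for a reduced expression; $R_{u,v}$ defined by $(H_{v^{-1}})^{-1}=\sum_u R_{u,v}(t)H_u$, and $\tilde{R}_{u,v}\in\mathbb{N}[t]$ is the unique polynomial with $R_{u,v}(t)=\tilde{R}_{u,v}(t-t^{-1})$. Diagrammatic polynomials: An $S$-graph is a finite planar graph with boundary in $\mathbb{R}\times[0,1]$, edges coloured by $S$, vertices either univalent (''dots'') or $2m_{st}$-valent ($m_{st}$ the order of $st$) with edges alternately coloured $s,t$; the top sequence is the word read on the top boundary; the degree is the number of dots. For a word $\underline{v}=s_1\cdots s_m$, the tree $\mathbb{T}_{\underline{v}}$ has root decorated by the empty diagram; a node of depth $k-1$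 decorated by $D$ with top sequence a reduced expression $\underline{u}$ of $u$ has: if $\ell(us_k)>\ell(u)$, two children ($D$ plus an $s_k$-coloured straight strand on the right, top $\underline{u}s_k$; $D$ plus an $s_k$ strand ending in a dot on the right, top $\underline{u}$, degree $+1$); if $\ell(us_k)<\ell(u)$, one child obtained by stacking $2m_{st}$-valent vertices on $D$ realizing braid moves from $\underline{u}$ to a reduced expression $\underline{u}''s_k$, then joining the rightmost top $s_k$ strand to a new $s_k$ strand from the bottom by an arc (top $\underline{u}''$, degree unchanged). The leaves are light leaves; $\mathbb{L}_{\underline{v}}(u)$ is the set of those with top sequence a reduced expression of $u$, and $\tilde{\mathcal{R}}_{u,\underline{v}}(t)=\sum_{l\in\mathbb{L}_{\underline{v}}(u)}t^{\deg(l)}$. *)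

(* Defs.v *)
From HB Require Import structures.
From mathcomp Require Import all_boot all_order all_fingroup all_algebra.
From mathcomp Require Import generic_quotient fraction.
From mathcomp Require Import boolp classical_sets.

Set Implicit Arguments.
Unset Strict Implicit.
Unset Printing Implicit Defensive.

Import GRing.Theory.

Local Open Scope ring_scope.
Local Open Scope quotient_scope.

Section Coxeter.
Variable n : nat.

Lemma adj_subproof m (i : 'I_m.-1) : (i.+1 < m)%N.
Proof. by rewrite -ltn_predRL ltn_ord. Qed.

Definition lo m (i : 'I_m.-1) : 'I_m := Ordinal (ltnW (adj_subproof i)).
Definition hi m (i : 'I_m.-1) : 'I_m := Ordinal (adj_subproof i).

(* Points and letters are numbered from 0: [i : 'I_n.-1] stands for s_(i+1). *)
Definition cgen (i : 'I_n.-1) : 'S_n := tperm (lo i) (hi i).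

Definition word := seq 'I_n.-1.

(* MathComp composes permutations from left to right; one-line notation and
   words are read here with the usual composition (u v)(x) = u (v x). *)
Definition pcomp (u v : 'S_n) : 'S_n := (v * u)%g.

Lemma pcompE u v x : pcomp u v x = u (v x).
Proof. exact: permM. Qed.

Definition wprod (w : word) : 'S_n := foldr (pcomp \o cgen) 1%g w.

Lemma wprod_cat a b : wprod (a ++ b) = pcomp (wprod a) (wprod b).
Proof.
by elim: a => [|i a IHa] /=; rewrite /pcomp ?mulg1 // IHa /pcomp mulgA.
Qed.

Lemma wprod_tperm (x y : 'I_n) : exists w, wprod w = tperm x y.
Proof.
wlog le_xy : x y / (x <= y)%N.
  move=> IH; case: (leqP x y) => [/IH // | /ltnW/IH [w Ew]].
  by exists w; rewrite tpermC.
move Ed : (y - x)%N => d; elim: d => [|d IHd] in y le_xy Ed *.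
  exists [::]; have -> : x = y by apply/val_inj/eqP; rewrite eqn_leq le_xy -subn_eq0 Ed /=.
  by rewrite tperm1.
have lt_xy : (x < y)%N by rewrite -subn_gt0 Ed.
have y'P : (y.-1 < n.-1)%N.
  by rewrite ltn_predRL prednK ?ltn_ord // (leq_ltn_trans _ lt_xy).
pose i := Ordinal y'P.
have hiE : hi i = y by apply/val_inj; rewrite /= prednK // (leq_ltn_trans _ lt_xy).
have y1 : (x <= lo i)%N by rewrite /= -ltnS prednK // (leq_ltn_trans _ lt_xy).
have [|w Ew] := IHd (lo i) y1; first by rewrite /= -subn1 subnAC Ed subn1.
case: (eqVneq x (lo i)) => [xE | x_lo].
  by exists [:: i]; rewrite /= /pcomp mul1g /cgen hiE xE.
have x_hi : x != hi i by rewrite hiE neq_ltn lt_xy.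
exists (i :: w ++ [:: i]); rewrite /= wprod_cat Ew /pcomp /= /pcomp mul1g.
rewrite -{1}[cgen i]tpermV -mulgA -conjgE tpermJ.
by rewrite /cgen tpermD 1?eq_sym // tpermL hiE.
Qed.

Lemma ex_word (u : 'S_n) :
  exists k, [exists w : k.-tuple 'I_n.-1, wprod w == u].
Proof.
suff [w <-] : exists w, wprod w = u.
  by exists (size w); apply/existsP; exists (in_tuple w).
have [ts -> _] := prod_tpermP u; elim: ts => [|t ts [w IH]].
  by exists [::]; rewrite big_nil.
have [w' Ew'] := wprod_tperm t.1 t.2.
by exists (w ++ w'); rewrite big_cons wprod_cat IH Ew'.
Qed.

Definition cox_length (u : 'S_n) : nat := ex_minn (ex_word u).

Definition reduced_expr (w : word) (u : 'S_n) : bool :=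
  (wprod w == u) && (size w == cox_length u).

Lemma ex_reduced u :
  exists w : (cox_length u).-tuple 'I_n.-1, wprod w == u.
Proof. by rewrite /cox_length; case: ex_minnP => k /existsP. Qed.

Definition reduced_word (u : 'S_n) : word := xchoose (ex_reduced u).

Lemma reduced_wordP u : reduced_expr (reduced_word u) u.
Proof.
by rewrite /reduced_expr size_tuple eqxx andbT; apply: (xchooseP (ex_reduced u)).
Qed.

Definition cox_m (i j : 'I_n.-1) : nat := #[pcomp (cgen i) (cgen j)]%g.

Fixpoint alt (i j : 'I_n.-1) (m : nat) : word :=
  if m is m'.+1 then i :: alt j i m' else [::].

End Coxeter.

(* Z[t, t^-1], as the subring of the fraction field of Z[t] consisting of the
   p / t^k. *)
Definition tfrac : {fraction {poly int}} := tofrac 'X.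

Definition is_laurent : {pred {fraction {poly int}}} :=
  [pred x | `[< exists p k, x = tofrac p / tfrac ^+ k >]].

Lemma tfrac_neq0 : tfrac != 0.
Proof. by rewrite /tfrac tofrac_eq0 polyX_eq0. Qed.

Lemma is_laurent_subring : subring_closed is_laurent.
Proof.
have tk k : tfrac ^+ k != 0 by rewrite expf_neq0 // tfrac_neq0.
split.
- by apply/asboolP; exists 1, 0; rewrite tofrac1 expr0 divr1.
- move=> x y /asboolP[p [k ->]] /asboolP[q [l ->]]; apply/asboolP.
  exists (p * 'X^l - q * 'X^k), (k + l)%N.
  rewrite tofracB !tofracM !tofracXn -/tfrac exprD mulrBl.
  congr (_ - _).
    by rewrite -mulf_div divff ?mulr1.
  by rewrite [_ ^+ k * _]mulrC -mulf_div divff ?mulr1.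
- move=> x y /asboolP[p [k ->]] /asboolP[q [l ->]]; apply/asboolP.
  by exists (p * q), (k + l)%N; rewrite mulf_div tofracM exprD.
Qed.

HB.instance Definition _ :=
  GRing.isSubringClosed.Build {fraction {poly int}} is_laurent
    is_laurent_subring.

Record laurent := Laurent {
  laurent_val :> {fraction {poly int}};
  laurent_valP : laurent_val \in is_laurent }.

HB.instance Definition _ := [isSub for laurent_val].
HB.instance Definition _ := [Choice of laurent by <:].
HB.instance Definition _ := [SubChoice_isSubComNzRing of laurent by <:].

Fact lt_subproof : tfrac \in is_laurent.
Proof. by apply/asboolP; exists 'X, 0; rewrite expr0 divr1. Qed.

Fact ltV_subproof : tfrac^-1 \in is_laurent.
Proof. by apply/asboolP; exists 1, 1; rewrite tofrac1 expr1 div1r. Qed.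

Definition Lt : laurent := Laurent lt_subproof.
Definition LtV : laurent := Laurent ltV_subproof.

Lemma LtK : Lt * LtV = 1.
Proof. by apply/val_inj; rewrite /= divff ?tfrac_neq0. Qed.

(* The Hecke algebra of S_n is the quotient of the formal algebra expressions
   in the generators by the least congruence containing the axioms of unital
   associative algebras, the quadratic relations and the braid relations. *)
Section Hecke.
Variable n : nat.

Inductive hterm : Type :=
| HGen of 'I_n.-1
| HZero
| HOpp of hterm
| HAdd of hterm & hterm
| HOne
| HMul of hterm & hterm
| HScale of laurent & hterm.

Definition hword (w : word n) : hterm := foldr HMul HOne (map HGen w).

Inductive heq : hterm -> hterm -> Prop :=
| heq_refl x : heq x x
| heq_sym x y : heq x y -> heq y x
| heq_trans x y z : heq x y -> heq y z -> heq x z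
| heq_opp x x' : heq x x' -> heq (HOpp x) (HOpp x')
| heq_add x x' y y' : heq x x' -> heq y y' -> heq (HAdd x y) (HAdd x' y')
| heq_mul x x' y y' : heq x x' -> heq y y' -> heq (HMul x y) (HMul x' y')
| heq_scale a x x' : heq x x' -> heq (HScale a x) (HScale a x')
| heq_addA x y z : heq (HAdd x (HAdd y z)) (HAdd (HAdd x y) z)
| heq_addC x y : heq (HAdd x y) (HAdd y x)
| heq_add0 x : heq (HAdd HZero x) x
| heq_addN x : heq (HAdd (HOpp x) x) HZero
| heq_mulA x y z : heq (HMul x (HMul y z)) (HMul (HMul x y) z)
| heq_mul1l x : heq (HMul HOne x) x
| heq_mul1r x : heq (HMul x HOne) x
| heq_mulDl x y z : heq (HMul (HAdd x y) z) (HAdd (HMul x z) (HMul y z))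
| heq_mulDr x y z : heq (HMul x (HAdd y z)) (HAdd (HMul x y) (HMul x z))
| heq_scaleA a b x : heq (HScale a (HScale b x)) (HScale (a * b) x)
| heq_scale1 x : heq (HScale 1 x) x
| heq_scaleDr a x y : heq (HScale a (HAdd x y)) (HAdd (HScale a x) (HScale a y))
| heq_scaleDl a b x : heq (HScale (a + b) x) (HAdd (HScale a x) (HScale b x))
| heq_scaleAl a x y : heq (HScale a (HMul x y)) (HMul (HScale a x) y)
| heq_scaleAr a x y : heq (HScale a (HMul x y)) (HMul x (HScale a y))
| heq_quad i :
    heq (HMul (HGen i) (HGen i)) (HAdd HOne (HScale (LtV - Lt) (HGen i)))
| heq_braid i j : i != j ->
    heq (hword (alt i j (cox_m i j))) (hword (alt j i (cox_m i j))).

HB.instance Definition _ := gen_eqMixin hterm.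
HB.instance Definition _ := gen_choiceMixin hterm.

Definition heqb : rel hterm := fun x y => `[< heq x y >].

Fact heqb_equiv : equiv_class_of heqb.
Proof.
split=> [x | x y | y x z].
- exact/asboolP/heq_refl.
- by apply/asboolP/asboolP; apply: heq_sym.
- by move=> /asboolP xy /asboolP yz; apply/asboolP/(heq_trans xy).
Qed.

Canonical heqb_equivRel := EquivRelPack heqb_equiv.

Definition hecke := {eq_quot heqb}.
HB.instance Definition _ := Choice.on hecke.
HB.instance Definition _ := EqQuotient.on hecke.

Definition hpi (x : hterm) : hecke := \pi_hecke x.

Lemma hpiP x y : reflect (heq x y) (hpi x == hpi y).
Proof. by rewrite /hpi eqmodE; apply: asboolP. Qed.

Lemma hpi_eq x y : heq x y -> hpi x = hpi y.
Proof. by move=> /hpiP/eqP. Qed.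

Lemma hreprK (x : hecke) : hpi (repr x) = x.
Proof. exact: reprK. Qed.

Lemma hrepr_pi x : heq (repr (hpi x)) x.
Proof. by apply/hpiP; rewrite hreprK. Qed.

Definition hopp (x : hecke) := hpi (HOpp (repr x)).
Definition hadd (x y : hecke) := hpi (HAdd (repr x) (repr y)).
Definition hmul (x y : hecke) := hpi (HMul (repr x) (repr y)).
Definition hscale a (x : hecke) := hpi (HScale a (repr x)).

Lemma hopp_pi x : hopp (hpi x) = hpi (HOpp x).
Proof. by apply/hpi_eq/heq_opp/hrepr_pi. Qed.
Lemma hadd_pi x y : hadd (hpi x) (hpi y) = hpi (HAdd x y).
Proof. by apply/hpi_eq/heq_add; apply: hrepr_pi. Qed.
Lemma hmul_pi x y : hmul (hpi x) (hpi y) = hpi (HMul x y).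
Proof. by apply/hpi_eq/heq_mul; apply: hrepr_pi. Qed.
Lemma hscale_pi a x : hscale a (hpi x) = hpi (HScale a x).
Proof. by apply/hpi_eq/heq_scale/hrepr_pi. Qed.

Definition h_pi := (hopp_pi, hadd_pi, hmul_pi, hscale_pi).

Ltac hlift c := repeat (let x := fresh in move=> x; try rewrite -[x]hreprK);
  rewrite !h_pi; apply: hpi_eq; exact: c.

Fact haddA : associative hadd. Proof. hlift heq_addA. Qed.
Fact haddC : commutative hadd. Proof. hlift heq_addC. Qed.
Fact hadd0 : left_id (hpi HZero) hadd. Proof. hlift heq_add0. Qed.
Fact haddN : left_inverse (hpi HZero) hopp hadd. Proof. hlift heq_addN. Qed.

HB.instance Definition _ := GRing.isZmodule.Build hecke haddA haddC hadd0 haddN.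

Fact hmulA : associative hmul. Proof. hlift heq_mulA. Qed.
Fact hmul1l : left_id (hpi HOne) hmul. Proof. hlift heq_mul1l. Qed.
Fact hmul1r : right_id (hpi HOne) hmul. Proof. hlift heq_mul1r. Qed.
Fact hmulDl : left_distributive hmul hadd. Proof. hlift heq_mulDl. Qed.
Fact hmulDr : right_distributive hmul hadd. Proof. hlift heq_mulDr. Qed.

(* The character H_s |-> t^-1; it shows that the relations do not collapse. *)
Fixpoint hchar (x : hterm) : laurent :=
  match x with
  | HGen _ => LtV
  | HZero => 0
  | HOpp x => - hchar x
  | HAdd x y => hchar x + hchar y
  | HOne => 1
  | HMul x y => hchar x * hchar y
  | HScale a x => a * hchar x
  end.

Lemma hchar_alt i j m : hchar (hword (alt i j m)) = LtV ^+ m.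
Proof. by elim: m i j => //= m IH i j; rewrite IH exprS. Qed.

Lemma hchar_eq x y : heq x y -> hchar x = hchar y.
Proof.
elim=> /=; try by move=> *; congruence.
- by move=> *; rewrite addrA.
- by move=> *; rewrite addrC.
- by move=> *; rewrite add0r.
- by move=> *; rewrite addNr.
- by move=> *; rewrite mulrA.
- by move=> *; rewrite mul1r.
- by move=> *; rewrite mulr1.
- by move=> *; rewrite mulrDl.
- by move=> *; rewrite mulrDr.
- by move=> *; rewrite mulrA.
- by move=> *; rewrite mul1r.
- by move=> *; rewrite mulrDr.
- by move=> *; rewrite mulrDl.
- by move=> *; rewrite mulrA.
- by move=> *; rewrite mulrCA.
- by move=> _; rewrite mulrBl LtK addrC subrK.
- by move=> *; rewrite !hchar_alt.
Qed.

Fact honeN0 : hpi HOne != 0.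
Proof.
apply/negP => /hpiP/hchar_eq /eqP.
by rewrite /= oner_eq0.
Qed.

HB.instance Definition _ :=
  GRing.Zmodule_isNzRing.Build hecke hmulA hmul1l hmul1r hmulDl hmulDr honeN0.

Fact hscaleA a b x : hscale a (hscale b x) = hscale (a * b) x.
Proof. by rewrite -[x]hreprK !h_pi; apply/hpi_eq/heq_scaleA. Qed.
Fact hscale1 : left_id 1 hscale. Proof. hlift heq_scale1. Qed.
Fact hscaleDr : right_distributive hscale +%R.
Proof.
move=> a x y; rewrite -[x]hreprK -[y]hreprK -![_ + _]/(hadd _ _) !h_pi.
exact/hpi_eq/heq_scaleDr.
Qed.
Fact hscaleDl x : {morph hscale^~ x : a b / a + b}.
Proof.
move=> a b; rewrite -[x]hreprK -[RHS]/(hadd _ _) !h_pi.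
exact/hpi_eq/heq_scaleDl.
Qed.

HB.instance Definition _ := GRing.Zmodule_isLmodule.Build laurent hecke
  hscaleA hscale1 hscaleDr hscaleDl.

Fact hscaleAl a (x y : hecke) : a *: (x * y) = (a *: x) * y.
Proof.
rewrite -[x]hreprK -[y]hreprK -![_ * _]/(hmul _ _) -![_ *: _]/(hscale _ _).
by rewrite !h_pi; apply/hpi_eq/heq_scaleAl.
Qed.

HB.instance Definition _ :=
  GRing.Lmodule_isLalgebra.Build laurent hecke hscaleAl.

Fact hscaleAr a (x y : hecke) : a *: (x * y) = x * (a *: y).
Proof.
rewrite -[x]hreprK -[y]hreprK -![_ * _]/(hmul _ _) -![_ *: _]/(hscale _ _).
by rewrite !h_pi; apply/hpi_eq/heq_scaleAr.
Qed.

HB.instance Definition _ :=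
  GRing.Lalgebra_isAlgebra.Build laurent hecke hscaleAr.

Definition is_hinv (x y : hecke) := y * x = 1 /\ x * y = 1.
Definition hunit : {pred hecke} := [pred x | `[< exists y, is_hinv x y >]].
Definition hinv (x : hecke) : hecke := xget x [set y | is_hinv x y].

Fact hinvP x : x \in hunit -> is_hinv x (hinv x).
Proof.
move=> /asboolP[y xy]; rewrite /hinv.
by case: xgetP => [z _ //|/(_ y)].
Qed.
Fact hmulVx : {in hunit, left_inverse 1 hinv *%R}.
Proof. by move=> x /hinvP[]. Qed.
Fact hmulxV : {in hunit, right_inverse 1 hinv *%R}.
Proof. by move=> x /hinvP[]. Qed.
Fact hunitP (x y : hecke) : y * x = 1 /\ x * y = 1 -> hunit x.
Proof. by move=> xy; apply/asboolP; exists y. Qed.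
Fact hinv_out : {in [predC hunit], hinv =1 id}.
Proof.
move=> x /negP nux; rewrite /hinv; case: xgetP => // y _ xy.
by case: nux; apply/asboolP; exists y.
Qed.

HB.instance Definition _ :=
  GRing.NzRing_hasMulInverse.Build hecke hmulVx hmulxV hunitP hinv_out.

Definition Hgen (i : 'I_n.-1) : hecke := hpi (HGen i).

(* Independent of the reduced word, by Matsumoto's theorem. *)
Definition Hperm (v : 'S_n) : hecke := \prod_(i <- reduced_word v) Hgen i.

(* The family (R_(u,v))_u for fixed v. *)
Definition Rfamily (v : 'S_n) : {ffun 'S_n -> laurent} :=
  xget [ffun=> 0] [set r : {ffun 'S_n -> laurent} |
    (Hperm v^-1%g)^-1 = \sum_(u : 'S_n) r u *: Hperm u].

Definition Rpoly (u v : 'S_n) : laurent := Rfamily v u.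

Definition Rtilde (u v : 'S_n) : {poly nat} :=
  xget 0 [set p : {poly nat} |
    Rpoly u v = (map_poly (GRing.natmul 1) p).[Lt - LtV]].

End Hecke.

(* Planar diagrams in R x [0,1] are presented by cutting them generically into
   elementary pieces: strands, dots, arcs and 2m_ij-valent vertices, placed
   side by side or stacked. *)
Section Diagrams.
Variable n : nat.

Inductive sgraph : Type :=
| Empty
| Strand of 'I_n.-1
| DotDown of 'I_n.-1            (* strand from the bottom, ending in a dot *)
| DotUp of 'I_n.-1              (* strand from the top, ending in a dot *)
| Cap of 'I_n.-1                (* arc with both ends on the bottom *)
| Cup of 'I_n.-1                (* arc with both ends on the top *)
| Vertex of 'I_n.-1 & 'I_n.-1
| Beside of sgraph & sgraph     (* left, right *)
| Stack of sgraph & sgraph.     (* lower, upper *)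

Fixpoint bot (D : sgraph) : word n :=
  match D with
  | Empty | DotUp _ | Cup _ => [::]
  | Strand i | DotDown i => [:: i]
  | Cap i => [:: i; i]
  | Vertex i j => alt i j (cox_m i j)
  | Beside D1 D2 => bot D1 ++ bot D2
  | Stack D1 D2 => bot D1
  end.

Fixpoint top (D : sgraph) : word n :=
  match D with
  | Empty | DotDown _ | Cap _ => [::]
  | Strand i | DotUp i => [:: i]
  | Cup i => [:: i; i]
  | Vertex i j => alt j i (cox_m i j)
  | Beside D1 D2 => top D1 ++ top D2
  | Stack D1 D2 => top D2
  end.

Fixpoint sgraph_wf (D : sgraph) : bool :=
  match D with
  | Vertex i j => i != j
  | Beside D1 D2 => sgraph_wf D1 && sgraph_wf D2
  | Stack D1 D2 => [&& sgraph_wf D1, sgraph_wf D2 & top D1 == bot D2]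
  | _ => true
  end.

Fixpoint degree (D : sgraph) : nat :=
  match D with
  | DotDown _ | DotUp _ => 1%N
  | Beside D1 D2 | Stack D1 D2 => (degree D1 + degree D2)%N
  | _ => 0%N
  end.

Definition strands (w : word n) : sgraph :=
  foldr (fun i => Beside (Strand i)) Empty w.

(* [braid_graph u B u']: B is a stack of vertices realizing a sequence of braid
   moves from u to u'. *)
Inductive braid_graph (u : word n) : sgraph -> word n -> Prop :=
| BraidId : braid_graph u (strands u) u
| BraidStep B a i j b : i != j ->
    braid_graph u B (a ++ alt i j (cox_m i j) ++ b) ->
    braid_graph u
      (Stack B (Beside (strands a) (Beside (Vertex i j) (strands b))))
      (a ++ alt j i (cox_m i j) ++ b).

Inductive dtree : Type :=
| Leaf of sgraph
| Node1 of sgraph & dtree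
| Node2 of sgraph & dtree & dtree.

(* [ll_subtree w D T]: T is a possible subtree hanging from a node decorated by
   D when w is the part of the word that remains to be read. The tree depends
   on the choice of the braid moves. *)
Inductive ll_subtree : word n -> sgraph -> dtree -> Prop :=
| LLLeaf D : ll_subtree [::] D (Leaf D)
| LLUp i w D T1 T0 :
    (cox_length (wprod (top D))
       < cox_length (pcomp (wprod (top D)) (cgen i)))%N ->
    ll_subtree w (Beside D (Strand i)) T1 ->
    ll_subtree w (Beside D (DotDown i)) T0 ->
    ll_subtree (i :: w) D (Node2 D T1 T0)
| LLDown i w D B u T :
    (cox_length (pcomp (wprod (top D)) (cgen i))
       < cox_length (wprod (top D)))%N ->
    braid_graph (top D) B (rcons u i) ->
    ll_subtree w
      (Stack (Beside (Stack D B) (Strand i)) (Beside (strands u) (Cap i))) T ->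
    ll_subtree (i :: w) D (Node1 D T).

Definition ll_tree (w : word n) (T : dtree) : Prop := ll_subtree w Empty T.

Fixpoint leaves (T : dtree) : seq sgraph :=
  match T with
  | Leaf D => [:: D]
  | Node1 _ T => leaves T
  | Node2 _ T1 T0 => leaves T1 ++ leaves T0
  end.

Definition light_leaves (T : dtree) (u : 'S_n) : seq sgraph :=
  [seq D <- leaves T | reduced_expr (top D) u].

Definition dRtilde (T : dtree) (u : 'S_n) : {poly nat} :=
  \sum_(D <- light_leaves T u) 'X^(degree D).

Lemma bot_strands w : bot (strands w) = w.
Proof. by elim: w => //= i w ->. Qed.

Lemma top_strands w : top (strands w) = w.
Proof. by elim: w => //= i w ->. Qed.

Lemma wf_strands w : sgraph_wf (strands w).
Proof. by elim: w. Qed.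

Lemma braid_graph_wf u B u' : braid_graph u B u' ->
  [/\ sgraph_wf B, bot B = u & top B = u'].
Proof.
elim=> [|{}B a i j b ij _ [wfB botB topB]].
  by rewrite wf_strands bot_strands top_strands.
by split=> //=; rewrite ?wfB ?wf_strands ?ij ?topB ?bot_strands ?top_strands ?eqxx.
Qed.

Lemma ll_tree_wf w T : ll_tree w T ->
  all (fun D => sgraph_wf D && (bot D == w)) (leaves T).
Proof.
suff gen D v : ll_subtree v D T -> sgraph_wf D ->
    all (fun D' => sgraph_wf D' && (bot D' == bot D ++ v)) (leaves T).
  by move=> /gen; apply.
elim=> {v D T} [D|i v D T1 T0 _ _ IH1 _ IH0|i v D B u T _ Bu _ IH] wfD /=.
- by rewrite wfD cats0 eqxx.
- have := IH1; have := IH0; rewrite /= wfD -!catA /= all_cat => IH0' IH1'.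
  by rewrite IH1' ?IH0'.
- have [wfB botB topB] := braid_graph_wf Bu.
  move: IH; rewrite /= -catA /=; apply.
  rewrite wfD wfB botB topB eqxx wf_strands bot_strands /=.
  by rewrite cats1 -!cats1 -catA eqxx.
Qed.

End Diagrams.

Fixpoint fib (m : nat) : {poly nat} :=
  match m with
  | 0 => 1
  | 1 => 'X
  | (m''.+1 as m').+1 => 'X * fib m' + fib m''
  end.

(* t^(m-1) F_(m+1); at m = 0 this is t^-1 F_1 = 1. *)
Definition modfib (m : nat) : {poly nat} :=
  if m is m'.+1 then 'X^m' * fib m.+1 else 1.

Fact vfun_subproof n (x : 'I_n) : (x.+2 %% n < n)%N.
Proof. by rewrite ltn_pmod // (leq_ltn_trans _ (ltn_ord x)). Qed.

(* One-line notation 3 4 ... n 1 2, on points numbered from 0. *)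
Definition vfun n (x : 'I_n) : 'I_n := Ordinal (vfun_subproof x).

Fact vfun_inj n : injective (@vfun n).
Proof.
move=> x y /(congr1 val) /= /eqP.
by rewrite -[x.+2]addn2 -[y.+2]addn2 eqn_modDr !modn_small // => /eqP/val_inj.
Qed.

Definition vperm n : 'S_n := perm (@vfun_inj n).

(* s_2 s_1 s_3 s_2 ... s_(n-1) s_(n-2) *)
Definition vword n : word n :=
  flatten [seq [:: hi k; lo k] | k <- enum 'I_n.-2].

(* Main.v *)
(** Right multiplication by [H_s^-1 = H_s + (t - t^-1)] sends [H_u] to
    [H_(us) + (t - t^-1) H_u] if [us > u] and to [H_(us)] if [us < u].  These are
    the branching rules of the light-leaf tree, so both polynomials count, with
    weight [t] for each dot, the paths from [e] to [u] along the reduced word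
    ([path_poly]).  Comparing coefficients requires the [H_u] to be well defined
    (Matsumoto's theorem) and independent (the regular representation), and
    [t - t^-1] to be transcendental.

    For the word [s_2 s_1 s_3 s_2 ...], a path back to [e] must have undone a
    letter by its last occurrence.  Only two states survive between consecutive
    pairs, [e] and the simple reflection just read, which gives the recursion
    [a_m = t^2 a_(m-1) + t^2 a_(m-2)] satisfied by [t^m F_m]. *)

From mathcomp Require Import all_boot all_order all_fingroup all_algebra.
From mathcomp Require Import generic_quotient fraction boolp classical_sets cyclic.
From mathcomp Require Import zify ring.
Require Import Defs.

Set Implicit Arguments.
Unset Strict Implicit.
Unset Printing Implicit Defensive.

Import GRing.Theory.
Local Open Scope ring_scope.

(** * Coxeter length as the number of inversions *)

Section Length.
Variable n : nat.
Implicit Types (u x y : 'S_n) (i j : 'I_n.-1) (w : word n).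

Lemma cgenE i (p : 'I_n) :
  cgen i p = (if p == i :> nat then i.+1 else if p == i.+1 :> nat then i : nat else p) :> nat.
Proof.
rewrite /cgen; case: tpermP => [->|->|/eqP + /eqP +] /=.
- by rewrite eqxx.
- by rewrite eqxx; case: ifP => // /eqP; lia.
- by rewrite -!val_eqE /= => /negbTE -> /negbTE ->.
Qed.

Lemma cgenK i : involutive (cgen i).
Proof. exact: tpermK. Qed.

Lemma pcomp_cgenK u i : pcomp (pcomp u (cgen i)) (cgen i) = u.
Proof. by rewrite /pcomp mulgA tperm2 mul1g. Qed.

Lemma wprod_rcons w i : wprod (rcons w i) = pcomp (wprod w) (cgen i).
Proof. by rewrite -cats1 wprod_cat /= /pcomp mul1g. Qed.

Lemma wprod_rev w : wprod (rev w) = (wprod w)^-1%g.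
Proof.
elim: w => [|i w IH] /=; first by rewrite invg1.
by rewrite rev_cons wprod_rcons IH /pcomp invMg tpermV.
Qed.

Definition inversions u : {set 'I_n * 'I_n} :=
  [set p : 'I_n * 'I_n | (p.1 < p.2)%N && (u p.2 < u p.1)%N].

(** Right multiplication by s_i swaps the values at two adjacent positions, so this comparison
    decides whether the length goes up or down ([ascentE]). *)
Definition ascent u i := (u (lo i) < u (hi i))%N.

Lemma descentP u i : ~~ ascent u i = (u (hi i) < u (lo i))%N.
Proof.
rewrite /ascent -leqNgt leq_eqVlt; case: eqP => //= /val_inj/perm_inj/(congr1 val) /=.
lia.
Qed.

Lemma ascent_pcomp u i : ascent (pcomp u (cgen i)) i = ~~ ascent u i.
Proof. by rewrite descentP /ascent !pcompE /cgen tpermL tpermR. Qed.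

(** Applying s_i to both entries of a pair carries the inversions of u bijectively onto those of u
    s_i other than (i, i+1), which is the new one. *)
Lemma card_inversions_ascent u i :
  ascent u i -> #|inversions (pcomp u (cgen i))| = #|inversions u|.+1.
Proof.
move=> ui; pose s p := (cgen i p.1, cgen i p.2).
have sK : involutive s by case=> a b; rewrite /s /= !cgenK.
have mem_s q : (q \in s @: inversions u) = (s q \in inversions u).
  by rewrite -{1}[q]sK mem_imset //; apply: inv_inj.
have -> : inversions (pcomp u (cgen i)) = (lo i, hi i) |: s @: inversions u.
  apply/setP=> -[a b]; rewrite !inE mem_s inE /=.
  rewrite !pcompE xpair_eqE -!val_eqE /=.
  have [Ea Eb] := (cgenE i a, cgenE i b).
  case: (eqVneq (a : nat) i) => [ai|ai].
    case: (eqVneq (b : nat) i.+1) => [bi|bi].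
      have -> : a = lo i by apply: val_inj.
      have -> : b = hi i by apply: val_inj.
      by rewrite /cgen tpermL tpermR /= ltnSn.
    by congr (_ && _); move: ai bi; rewrite Ea Eb; do !case: eqP; lia.
  case: (eqVneq (a : nat) i.+1) => [ai'|ai'] /=; last first.
    by congr (_ && _); move: ai ai'; rewrite Ea Eb; do !case: eqP; lia.
  case: (eqVneq (b : nat) i) => [bi|bi]; last first.
    by congr (_ && _); move: ai ai' bi; rewrite Ea Eb; do !case: eqP; lia.
  have -> : a = hi i by apply: val_inj.
  have -> : b = lo i by apply: val_inj.
  by rewrite /cgen tpermL tpermR /= ltnSn ltnNge leqnSn /= [RHS]ltnNge ltnW.
rewrite cardsU1 card_imset; last exact: inv_inj.
by rewrite mem_s inE /= /cgen tpermL tpermR /= ltnNge leqnSn.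
Qed.

Lemma card_inversions_descent u i :
  ~~ ascent u i -> #|inversions u| = #|inversions (pcomp u (cgen i))|.+1.
Proof.
rewrite -ascent_pcomp => /card_inversions_ascent.
by rewrite pcomp_cgenK.
Qed.

Lemma card_inversions1 : #|inversions 1%g| = 0%N.
Proof.
apply/eqP; rewrite cards_eq0; apply/eqP/setP=> -[a b]; rewrite !inE !perm1 /=.
by case: ltngtP.
Qed.

Lemma leq_inversions_size w : (#|inversions (wprod w)| <= size w)%N.
Proof.
elim/last_ind: w => [|w i IH]; first by rewrite card_inversions1.
rewrite wprod_rcons size_rcons.
have [/card_inversions_ascent -> //|/card_inversions_descent E] := boolP (ascent (wprod w) i).
by move: IH; rewrite E; lia.
Qed.

(** Over a distance d the values grow by at least d. Comparing a with both end points of the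
    interval then leaves only the value a. *)
Lemma no_descent u : (forall i, ascent u i) -> u = 1%g.
Proof.
move=> asc; have mono d (a b : 'I_n) : b = (a + d)%N :> nat -> (u a + d <= u b)%N.
  elim: d b => [|d IH] b; first by rewrite addn0 => /val_inj ->; rewrite addn0.
  move=> Eb; have ltd : (a + d < n.-1)%N by have := ltn_ord b; lia.
  have := asc (Ordinal ltd); rewrite /ascent.
  have -> : hi (Ordinal ltd) = b by apply: val_inj; rewrite /= Eb addnS.
  by have := IH (lo (Ordinal ltd)) erefl; lia.
apply/permP=> a; rewrite perm1; apply: val_inj => /=.
have n_gt0 : (0 < n)%N by have := ltn_ord a; lia.
have ltn1 : (n.-1 < n)%N by lia.
have := mono a (Ordinal n_gt0) a; have := mono (n.-1 - a)%N a (Ordinal ltn1).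
have := ltn_ord a; have := ltn_ord (u (Ordinal ltn1)); move=> /=; lia.
Qed.

Lemma ex_word_inversions u : exists2 w, wprod w = u & size w = #|inversions u|.
Proof.
move Ek : #|inversions u| => k; elim: k u Ek => [|k IH] u Ek.
  exists [::] => //; symmetry; apply: no_descent => i.
  by apply/negPn/negP=> /card_inversions_descent; rewrite Ek.
have [i di] : exists i, ~~ ascent u i.
  apply/existsP; rewrite -negb_forall; apply/negP=> /forallP/no_descent u1.
  by rewrite u1 card_inversions1 in Ek.
have [|w Ew sw] := IH (pcomp u (cgen i)).
  by have := card_inversions_descent di; rewrite Ek => -[].
by exists (rcons w i); rewrite ?size_rcons ?sw // wprod_rcons Ew pcomp_cgenK.
Qed.

Lemma cox_lengthE u : cox_length u = #|inversions u|.
Proof.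
rewrite /cox_length; case: ex_minnP => k /existsP[t /eqP Et] kmin.
apply/eqP; rewrite eqn_leq; apply/andP; split.
  have [w Ew <-] := ex_word_inversions u.
  by apply: kmin; apply/existsP; exists (in_tuple w); rewrite /= Ew.
by have := leq_inversions_size t; rewrite Et size_tuple.
Qed.

Lemma cox_length_ascent u i :
  ascent u i -> cox_length (pcomp u (cgen i)) = (cox_length u).+1.
Proof. by rewrite !cox_lengthE; apply: card_inversions_ascent. Qed.

Lemma cox_length_descent u i :
  ~~ ascent u i -> cox_length u = (cox_length (pcomp u (cgen i))).+1.
Proof. by rewrite !cox_lengthE; apply: card_inversions_descent. Qed.

Lemma ascentE u i :
  (cox_length u < cox_length (pcomp u (cgen i)))%N = ascent u i.
Proof.
have [/cox_length_ascent -> | /cox_length_descent ->] := boolP (ascent u i).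
  exact: ltnSn.
by rewrite ltnNge leqnSn.
Qed.

Lemma descentE u i :
  (cox_length (pcomp u (cgen i)) < cox_length u)%N = ~~ ascent u i.
Proof.
have [/cox_length_ascent -> | /cox_length_descent ->] := boolP (ascent u i).
  by rewrite ltnNge leqnSn.
exact: ltnSn.
Qed.

Lemma cox_length1 : cox_length (1%g : 'S_n) = 0%N.
Proof. by rewrite cox_lengthE card_inversions1. Qed.

(** Lets reduced words be handled by their last letter. If i were an ascent of u, then w would be a
    word for u s_i with fewer letters than inversions. *)
Lemma reduced_rconsE w i u :
  reduced_expr (rcons w i) u =
  ~~ ascent u i && reduced_expr w (pcomp u (cgen i)).
Proof.
rewrite /reduced_expr wprod_rcons size_rcons.
have -> : (pcomp (wprod w) (cgen i) == u) = (wprod w == pcomp u (cgen i)).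
  by apply/eqP/eqP=> [<- | ->]; rewrite pcomp_cgenK.
case: eqP => [Ew|]; rewrite ?andbF //=.
have [ui|/cox_length_descent -> //] := boolP (ascent u i).
apply/eqP=> Es; have := leq_inversions_size w.
by rewrite -cox_lengthE Ew cox_length_ascent // -Es; lia.
Qed.

Lemma reduced_rcons_ascent w i u : reduced_expr w u -> ascent u i ->
  reduced_expr (rcons w i) (pcomp u (cgen i)).
Proof. by rewrite reduced_rconsE ascent_pcomp negbK pcomp_cgenK => -> ->. Qed.

(** Reversing a shortest word for either element gives a word for the other, so both have the same
    length. Needed because R is read off from H indexed by the inverse of v. *)
Lemma reduced_rev w u : reduced_expr w u -> reduced_expr (rev w) u^-1%g.
Proof.
move=> /andP[/eqP Ew /eqP sw]; rewrite /reduced_expr wprod_rev Ew eqxx size_rev /=.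
rewrite eqn_leq; apply/andP; split; last first.
  by rewrite cox_lengthE -Ew -wprod_rev -(size_rev w) leq_inversions_size.
rewrite [cox_length _^-1%g]cox_lengthE sw.
have [w' Ew' <-] := ex_word_inversions u^-1%g.
have := leq_inversions_size (rev w').
by rewrite wprod_rev Ew' invgK size_rev cox_lengthE.
Qed.

End Length.

(** * Braid relations and Matsumoto's theorem *)

Section Matsumoto.
Variable n : nat.
Implicit Types (u : 'S_n) (i j : 'I_n.-1) (w : word n).

Lemma cox_m_far i j : (i.+1 < j)%N -> cox_m i j = 2%N.
Proof.
move=> ltij; apply: nt_prime_order => //.
  apply/permP=> p; apply: val_inj; rewrite /pcomp expgS expg1 !permM perm1.
  by rewrite /= !cgenE; do !case: eqP => /=; lia.
apply/eqP=> /permP/(_ (lo i))/(congr1 val); rewrite permM perm1 /= !cgenE /=.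
by do !case: eqP => /=; lia.
Qed.

Lemma cox_m_next i j : j = i.+1 :> nat -> cox_m i j = 3%N.
Proof.
move=> Eij; apply: nt_prime_order => //.
  apply/permP=> p; apply: val_inj; rewrite /pcomp !expgS expg0 mulg1 !permM perm1.
  by rewrite /= !cgenE Eij; do !case: eqP => /=; lia.
apply/eqP=> /permP/(_ (lo i))/(congr1 val); rewrite permM perm1 /= !cgenE /=.
by do !case: eqP => /=; lia.
Qed.

Lemma cox_mC i j : cox_m i j = cox_m j i.
Proof. by rewrite /cox_m -orderV /pcomp invMg !tpermV. Qed.

Lemma cgen_commute i j : (i.+1 < j)%N -> (cgen i * cgen j = cgen j * cgen i)%g.
Proof.
move=> lt; apply/permP=> p; apply: val_inj; rewrite !permM /= !cgenE.
by do !case: eqP => /=; lia.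
Qed.

Lemma cgen_braid i j : j = i.+1 :> nat ->
  (cgen i * cgen j * cgen i = cgen j * cgen i * cgen j)%g.
Proof.
move=> Eij; apply/permP=> p; apply: val_inj; rewrite !permM /= !cgenE Eij.
by do !case: eqP => /=; lia.
Qed.

(** The three consecutive points are named [lo i], [lo j], [hi j], with [hi i] equal to [lo j]. This
    is the action of the two generators on them. *)
Lemma cgen_next i j : j = i.+1 :> nat ->
  [/\ cgen i (lo i) = lo j, cgen i (lo j) = lo i, cgen i (hi j) = hi j &
   [/\ cgen j (lo i) = lo i, cgen j (lo j) = hi j & cgen j (hi j) = lo j]].
Proof.
by move=> Eij; do !split; apply: val_inj; rewrite /= cgenE /=;
  do !case: eqP => /=; lia.
Qed.

(** Phrased with diagrams so that Matsumoto's theorem also yields the stacks of vertices that light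
    leaves require. *)
Definition braid_equiv w w' := exists B, braid_graph w B w'.

Lemma braid_equiv_refl w : braid_equiv w w.
Proof. by exists (strands w); apply: BraidId. Qed.

Lemma braid_equiv_trans w1 w2 w3 :
  braid_equiv w1 w2 -> braid_equiv w2 w3 -> braid_equiv w1 w3.
Proof.
move=> w12 [B]; elim=> [//|{}B a i j b ij _ [B' IH]].
by eexists; apply: BraidStep IH.
Qed.

Lemma braid_equiv_cat w w' c : braid_equiv w w' -> braid_equiv (w ++ c) (w' ++ c).
Proof.
move=> [B]; elim=> [|{}B a i j b ij _ [B' IH]]; first exact: braid_equiv_refl.
rewrite -!catA in IH *; by eexists; apply: BraidStep IH.
Qed.

Lemma braid_equiv_alt a i j : i != j ->
  braid_equiv (a ++ alt i j (cox_m i j)) (a ++ alt j i (cox_m i j)).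
Proof.
move=> ij; have [B H] := braid_equiv_refl (a ++ alt i j (cox_m i j)).
by eexists; rewrite -[alt j i _]cats0; apply: BraidStep ij _; rewrite cats0; apply: H.
Qed.

Lemma ascent_far u i j : (i.+1 < j)%N || (j.+1 < i)%N ->
  ascent (pcomp u (cgen i)) j = ascent u j.
Proof.
move=> far; rewrite /ascent !pcompE; congr (val (u _) < val (u _))%N;
  by apply: val_inj; rewrite /= cgenE /=; do !case: eqP => /=; lia.
Qed.

(* Below two distinct descents i and j, the permutation ends with the longest
   element of the parabolic subgroup generated by s_i and s_j. *)
Lemma common_reduced u i j : i != j -> ~~ ascent u i -> ~~ ascent u j ->
  exists a b, [/\ reduced_expr (rcons a i) u, reduced_expr (rcons b j) u,
    braid_equiv (rcons a i) (rcons b j) & braid_equiv (rcons b j) (rcons a i)].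
Proof.
wlog ltij : i j / (i < j)%N.
  move=> W ij di dj; case: (ltngtP i j) => [lt|lt|/val_inj E].
  - exact: W.
  - by rewrite eq_sym in ij; have [b [a []]] := W _ _ lt ij dj di; exists a, b.
  - by rewrite E eqxx in ij.
move=> ij di dj; have ji : j != i by rewrite eq_sym.
case: (ltngtP i.+1 j) => [far|lt|Eij]; [|lia|].
  (* Commuting case: u ends both in s_j s_i and in s_i s_j, after the same prefix x. *)
  have [x rx] : exists x, reduced_expr x (pcomp (pcomp u (cgen i)) (cgen j)).
    by eexists; apply: reduced_wordP.
  exists (rcons x j), (rcons x i).
  rewrite !reduced_rconsE di dj !ascent_far ?far ?orbT // di dj rx.
  have -> : pcomp (pcomp u (cgen j)) (cgen i) = pcomp (pcomp u (cgen i)) (cgen j).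
    by rewrite /pcomp !mulgA cgen_commute.
  rewrite rx; split=> //.
    have := braid_equiv_alt x ji; rewrite (cox_mC j) cox_m_far //=.
    by rewrite -!cats1 -!catA.
  have := braid_equiv_alt x ij; rewrite cox_m_far //=.
  by rewrite -!cats1 -!catA.
(* Adjacent case: u decreases along three consecutive positions, so it ends in s_i s_j s_i, which is
   also s_j s_i s_j, after the prefix x. *)
have [x rx] : exists x, reduced_expr x (pcomp (pcomp (pcomp u (cgen i)) (cgen j)) (cgen i)).
  by eexists; apply: reduced_wordP.
have hij : hi i = lo j by apply: val_inj.
have [i1 i2 i3 [j1 j2 j3]] := cgen_next (esym Eij).
rewrite !descentP hij in di dj.
have dd := ltn_trans dj di.
exists (rcons (rcons x i) j), (rcons (rcons x j) i).
rewrite !reduced_rconsE !descentP !pcompE hij !(i1, i2, i3, j1, j2, j3) di dd rx.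
have -> : pcomp (pcomp (pcomp u (cgen j)) (cgen i)) (cgen j) =
          pcomp (pcomp (pcomp u (cgen i)) (cgen j)) (cgen i).
  by rewrite /pcomp !mulgA (cgen_braid (esym Eij)).
rewrite rx dj; split=> //.
  have := braid_equiv_alt x ij; rewrite cox_m_next //=.
  by rewrite -!cats1 -!catA.
have := braid_equiv_alt x ji; rewrite (cox_mC j) cox_m_next //=.
by rewrite -!cats1 -!catA.
Qed.

(** Induction on the length. A common last letter is stripped. For different last letters, both
    words are joined to the pair from [common_reduced], each sharing its last letter with one
    member. *)
Theorem Matsumoto u w w' :
  reduced_expr w u -> reduced_expr w' u -> braid_equiv w w'.
Proof.
move Ek : (size w) => k; elim: k u w w' Ek => [|k IH] u w w' Ek rw rw'.
  rewrite (size0nil Ek) in rw *.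
  case/andP: rw rw' => /eqP <- _ /andP[_]; rewrite cox_length1 size_eq0 => /eqP ->.
  exact: braid_equiv_refl.
have rcons_equiv i x x' : size x = k -> reduced_expr (rcons x i) u ->
    reduced_expr (rcons x' i) u -> braid_equiv (rcons x i) (rcons x' i).
  rewrite !reduced_rconsE => sx /andP[_ rx] /andP[_ rx'].
  by rewrite -!cats1; apply: braid_equiv_cat; apply: IH rx rx'.
have size_red x : reduced_expr x u -> size x = k.+1.
  by move=> /andP[_ /eqP ->]; case/andP: rw => _ /eqP <-.
case/lastP: w Ek rw => // w i; rewrite size_rcons => -[sw] rw.
case/lastP: w' rw' => [/size_red //|w' j] rw'.
have [Eij|ij] := eqVneq i j; first by subst j; apply: rcons_equiv.
have [di dj] : ~~ ascent u i /\ ~~ ascent u j.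
  by move: rw rw'; rewrite !reduced_rconsE => /andP[-> _] /andP[-> _].
have [a [b [ra rb ab _]]] := common_reduced ij di dj.
have sb : size b = k by move/size_red: rb; rewrite size_rcons => -[].
apply: (braid_equiv_trans (rcons_equiv _ _ _ sw rw ra)).
exact: (braid_equiv_trans ab (rcons_equiv _ _ _ sb rb rw')).
Qed.

End Matsumoto.

(** * Regular representation of the Hecke algebra and its standard basis *)

Section HeckeBasis.
Variable n : nat.
Implicit Types (u x y : 'S_n) (i j : 'I_n.-1) (w : word n).
Implicit Types (f g : 'S_n -> laurent).

Let z : laurent := Lt - LtV.

(** Right multiplication by H_s in coordinates: f stands for the sum of the f(x) H_x, where H_x H_s
    is H_(xs) at an ascent and H_(xs) - z H_x at a descent. *)
Definition hact i f u : laurent :=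
  f (pcomp u (cgen i)) - (if ascent u i then 0 else z) * f u.

Lemma hact_quad i f u : hact i (hact i f) u = f u + (LtV - Lt) * hact i f u.
Proof.
rewrite -opprB -/z /hact ascent_pcomp pcomp_cgenK.
by case: ascent => /=; ring.
Qed.

Lemma hact_commute i j f u : (i.+1 < j)%N ->
  hact i (hact j f) u = hact j (hact i f) u.
Proof.
move=> far; rewrite /hact !ascent_far ?far ?orbT //.
have -> : pcomp (pcomp u (cgen j)) (cgen i) = pcomp (pcomp u (cgen i)) (cgen j).
  by rewrite /pcomp !mulgA cgen_commute.
by do 2!case: ascent => /=; ring.
Qed.

Lemma hact_braid i j f u : j = i.+1 :> nat ->
  hact i (hact j (hact i f)) u = hact j (hact i (hact j f)) u.
Proof.
move=> Eij; have hij : hi i = lo j by apply: val_inj.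
have [i1 i2 i3 [j1 j2 j3]] := cgen_next Eij.
rewrite /hact !pcomp_cgenK.
have -> : pcomp (pcomp (pcomp u (cgen j)) (cgen i)) (cgen j) =
          pcomp (pcomp (pcomp u (cgen i)) (cgen j)) (cgen i).
  by rewrite /pcomp !mulgA (cgen_braid Eij).
rewrite /ascent !pcompE hij !(i1, i2, i3, j1, j2, j3).
have pq : u (lo i) != u (lo j) :> nat.
  by rewrite (inj_eq val_inj) (inj_eq perm_inj) -hij -val_eqE /= neq_ltn ltnSn.
have qr : u (lo j) != u (hi j) :> nat.
  by rewrite (inj_eq val_inj) (inj_eq perm_inj) -val_eqE /= neq_ltn ltnSn.
have pr : u (lo i) != u (hi j) :> nat.
  by rewrite (inj_eq val_inj) (inj_eq perm_inj) -val_eqE /= Eij; lia.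
(* The values of f on the coset of u under the subgroup generated by s_i and s_j become six atoms.
   The relative order of three values of u then decides every ascent. *)
move: (f u) (f _) (f _) (f _) (f _) (f _) z => f0 f1 f2 f3 f4 f5 c.
case: (ltngtP (u (lo i)) (u (lo j))) pq => // pq _;
case: (ltngtP (u (lo j)) (u (hi j))) qr => // qr _;
case: (ltngtP (u (lo i)) (u (hi j))) pr => // pr _; try lia; ring.
Qed.

(** A right action, hence the left factor of a product acts first. [hrep_sound] makes it descend to
    the quotient. *)
Fixpoint hrep (a : hterm n) f : 'S_n -> laurent :=
  match a with
  | HGen i => hact i f
  | HZero => fun=> 0
  | HOpp a => fun u => - hrep a f u
  | HAdd a b => fun u => hrep a f u + hrep b f u
  | HOne => f
  | HMul a b => hrep b (hrep a f)
  | HScale c a => fun u => c * hrep a f u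
  end.

(** The axioms of [heq] that distribute or move scalars past a left factor hold only because each
    operator is linear. *)
Lemma hrep_linear a c f g :
  hrep a (fun u => c * f u + g u) = fun u => c * hrep a f u + hrep a g u.
Proof.
elim: a c f g => [i||a IH|a IHa b IHb||a IHa b IHb|d a IH] c f g /=.
- by apply/funext=> u; rewrite /hact; ring.
- by apply/funext=> u; ring.
- by apply/funext=> u; rewrite IH; ring.
- by apply/funext=> u; rewrite IHa IHb; ring.
- by [].
- by rewrite IHa IHb.
- by apply/funext=> u; rewrite IH; ring.
Qed.

Lemma hrepD a f g : hrep a (fun u => f u + g u) = fun u => hrep a f u + hrep a g u.
Proof.
have -> : (fun u => f u + g u) = (fun u => 1 * f u + g u).
  by apply/funext=> u; rewrite mul1r.
by rewrite hrep_linear; apply/funext=> u; rewrite mul1r.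
Qed.

Lemma hrep0 a : hrep a (fun=> 0) = fun=> 0.
Proof.
have E : (fun=> 0) = (fun u => -1 * (fun=> 0) u + (fun=> 0) u) :> ('S_n -> laurent).
  by apply/funext=> u; ring.
by rewrite {1}E hrep_linear; apply/funext=> u; ring.
Qed.

Lemma hrepZ a c f : hrep a (fun u => c * f u) = fun u => c * hrep a f u.
Proof.
have -> : (fun u => c * f u) = (fun u => c * f u + (fun=> 0) u).
  by apply/funext=> u; rewrite addr0.
by rewrite hrep_linear hrep0; apply/funext=> u; rewrite addr0.
Qed.

Lemma hrep_braid i j f : i != j ->
  hrep (hword (alt i j (cox_m i j))) f = hrep (hword (alt j i (cox_m i j))) f.
Proof.
wlog ltij : i j / (i < j)%N.
  move=> W ij; case: (ltngtP i j) => [lt|lt|/val_inj E].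
  - exact: W.
  - by rewrite cox_mC; symmetry; apply: W; rewrite // eq_sym.
  - by rewrite E eqxx in ij.
move=> _; apply/funext=> u; case: (ltngtP i.+1 j) => [far|lt|Eij]; [|lia|].
  by rewrite cox_m_far //= (hact_commute _ _ far).
by rewrite cox_m_next //= (hact_braid _ _ (esym Eij)).
Qed.

Lemma hrep_sound a b f : heq a b -> hrep a f = hrep b f.
Proof.
move=> ab; elim: ab f => {a b} /=; try by move=> *; congruence.
- by move=> a a' _ IH f; rewrite IH.
- by move=> a a' b b' _ IHa _ IHb f; rewrite IHa IHb.
- by move=> c a a' _ IH f; rewrite IH.
- by move=> a b c f; apply/funext=> u; ring.
- by move=> a b f; apply/funext=> u; ring.
- by move=> a f; apply/funext=> u; ring.
- by move=> a f; apply/funext=> u; ring.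
- by move=> a b c f; rewrite hrepD.
- by move=> c d a f; apply/funext=> u; ring.
- by move=> a f; apply/funext=> u; ring.
- by move=> c a b f; apply/funext=> u; ring.
- by move=> c d a f; apply/funext=> u; ring.
- by move=> c a b f; rewrite hrepZ.
- by move=> i f; apply/funext=> u; rewrite hact_quad.
- by move=> i j ij f; apply: hrep_braid.
Qed.

Definition delta x u : laurent := (u == x)%:R.

Definition heval (h : hecke n) : 'S_n -> laurent := hrep (repr h) (delta 1%g).

Lemma heval_pi a : heval (hpi a) = hrep a (delta 1%g).
Proof. exact/hrep_sound/hrepr_pi. Qed.

Lemma hevalD (h k : hecke n) u : heval (h + k) u = heval h u + heval k u.
Proof. by rewrite [h + k]/(hadd h k) /hadd heval_pi. Qed.

Lemma hevalZ c (h : hecke n) u : heval (c *: h) u = c * heval h u.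
Proof. by rewrite [c *: h]/(hscale c h) /hscale heval_pi. Qed.

Lemma heval0 u : heval 0 u = 0.
Proof. by rewrite [0]/(hpi (HZero n)) heval_pi. Qed.

Lemma heval1 : heval 1 = delta 1%g.
Proof. by rewrite [1]/(hpi (HOne n)) heval_pi. Qed.

Lemma heval_mulgen (h : hecke n) i : heval (h * Hgen i) = hact i (heval h).
Proof. by rewrite -[h * Hgen i]/(hmul _ _) -[h in LHS]hreprK h_pi heval_pi. Qed.

Lemma hact_delta i x : ascent x i -> hact i (delta x) = delta (pcomp x (cgen i)).
Proof.
move=> xi; apply/funext=> u; rewrite /hact /delta.
have -> : (pcomp u (cgen i) == x) = (u == pcomp x (cgen i)).
  by apply/eqP/eqP=> [<- | ->]; rewrite pcomp_cgenK.
by case: (eqVneq u x) => [->|_]; rewrite ?xi ?mul0r ?mulr0 subr0.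
Qed.

(** Along a reduced word every letter is an ascent, so the point mass at e is only moved and never
    split. *)
Lemma heval_reduced w u :
  reduced_expr w u -> heval (\prod_(i <- w) Hgen i) = delta u.
Proof.
elim/last_ind: w u => [|w i IH] u.
  by move=> /andP[/eqP <- _]; rewrite big_nil heval1.
rewrite reduced_rconsE => /andP[di rw].
rewrite big_rcons /= heval_mulgen (IH _ rw) hact_delta ?pcomp_cgenK //.
by rewrite ascent_pcomp.
Qed.

Lemma heval_Hperm u : heval (Hperm u) = delta u.
Proof. exact/heval_reduced/reduced_wordP. Qed.

(** This is the linear independence of the H_u, in the form used to compare coefficients. *)
Lemma heval_sum (r : 'S_n -> laurent) u :
  heval (\sum_x r x *: Hperm x) u = r u.
Proof.
rewrite (big_morph (heval^~ u) (fun h k => hevalD h k u) (heval0 u)).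
under eq_bigr do rewrite hevalZ heval_Hperm /delta.
rewrite (bigD1 u) //= eqxx mulr1 big1 ?addr0 // => x xu.
by rewrite eq_sym (negbTE xu) mulr0.
Qed.

Lemma hpi_hword w : hpi (hword w) = \prod_(i <- w) Hgen i.
Proof.
elim: w => [|i w IH]; first by rewrite big_nil.
by rewrite big_cons -IH -[_ * _]/(hmul _ _) h_pi.
Qed.

Lemma prod_Hgen_braid w w' : braid_equiv w w' ->
  \prod_(i <- w) Hgen i = \prod_(i <- w') Hgen i.
Proof.
move=> [B]; elim=> [//|{}B a i j b ij _ ->].
by rewrite !big_cat /= -!hpi_hword (hpi_eq (heq_braid ij)).
Qed.

Lemma prod_Hgen w u : reduced_expr w u -> \prod_(i <- w) Hgen i = Hperm u.
Proof. by move=> rw; apply/prod_Hgen_braid/(Matsumoto rw)/reduced_wordP. Qed.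

Lemma Hperm_ascent u i : ascent u i -> Hperm u * Hgen i = Hperm (pcomp u (cgen i)).
Proof.
move=> ui; rewrite -(prod_Hgen (reduced_rcons_ascent (reduced_wordP u) ui)).
by rewrite big_rcons.
Qed.

Lemma Hgen_quad i : Hgen i * Hgen i = 1 - z *: Hgen i.
Proof.
rewrite -scaleNr opprB -[LHS]/(hmul _ _) h_pi (hpi_eq (heq_quad i)).
by rewrite -hadd_pi -hscale_pi.
Qed.

Lemma Hgen_mulV i : Hgen i * (Hgen i + z%:A) = 1.
Proof. by rewrite mulrDr Hgen_quad -scalerAr mulr1 subrK. Qed.

Lemma Hgen_mulVl i : (Hgen i + z%:A) * Hgen i = 1.
Proof. by rewrite mulrDl Hgen_quad -scalerAl mul1r subrK. Qed.

Lemma prod_HgenV w :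
  (\prod_(i <- rev w) Hgen i)^-1 = \prod_(i <- w) (Hgen i + z%:A).
Proof.
suff [E1 E2] : \prod_(i <- w) (Hgen i + z%:A) * (\prod_(i <- rev w) Hgen i) = 1 /\
    (\prod_(i <- rev w) Hgen i) * \prod_(i <- w) (Hgen i + z%:A) = 1.
  have U : (\prod_(i <- rev w) Hgen i) \is a GRing.unit.
    by apply/unitrP; eexists; split; [exact: E1 | exact: E2].
  by apply: (mulrI U); rewrite E2 divrr.
elim: w => [|i w [IH1 IH2]]; first by rewrite !big_nil mulr1.
rewrite rev_cons !big_cons !big_rcons /=; split.
  by rewrite -mulrA [X in _ * X]mulrA IH1 mul1r Hgen_mulVl.
by rewrite -mulrA [X in _ * X]mulrA Hgen_mulV mul1r IH2.
Qed.

(** * Path polynomials and the R-polynomials *)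

Fixpoint path_poly x w y : {poly nat} :=
  if w is i :: w' then
    path_poly (pcomp x (cgen i)) w' y
    + (if ascent x i then 'X * path_poly x w' y else 0)
  else (x == y)%:R.

Definition evalz (p : {poly nat}) : laurent := (map_poly (GRing.natmul 1) p).[z].

Lemma Hperm_prod_path x w :
  Hperm x * \prod_(i <- w) (Hgen i + z%:A)
  = \sum_y evalz (path_poly x w y) *: Hperm y.
Proof.
elim: w x => [|i w IH] x /=.
  rewrite big_nil mulr1 (bigD1 x) //= eqxx big1.
    by rewrite addr0 /evalz rmorph1 hornerC scale1r.
  by move=> y yx; rewrite eq_sym (negbTE yx) /evalz rmorph0 horner0 scale0r.
rewrite big_cons mulrA mulrDr -scalerAr mulr1.
have [xi|xi] := boolP (ascent x i).
  rewrite Hperm_ascent // mulrDl -scalerAl !IH scaler_sumr -big_split /=.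
  apply: eq_bigr => y _; rewrite scalerA -scalerDl; congr (_ *: _).
  by rewrite /evalz rmorphD rmorphM /= map_polyX hornerD hornerM hornerX.
(* At a descent the quadratic relation cancels the z term, leaving the single branch H_(xs). *)
have Ex : Hperm x = Hperm (pcomp x (cgen i)) * Hgen i.
  by rewrite Hperm_ascent ?pcomp_cgenK // ascent_pcomp.
have -> : \sum_y evalz (path_poly (pcomp x (cgen i)) w y + 0) *: Hperm y =
    \sum_y evalz (path_poly (pcomp x (cgen i)) w y) *: Hperm y.
  by apply: eq_bigr => y _; rewrite addr0.
rewrite -IH; congr (_ * _).
by rewrite Ex -mulrA Hgen_quad mulrBr mulr1 -scalerAr subrK.
Qed.

Lemma RpolyE w u v :
  reduced_expr w v -> Rpoly u v = evalz (path_poly 1%g w u).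
Proof.
move=> rw; rewrite /Rpoly /Rfamily.
have E : (Hperm v^-1%g)^-1 = \sum_y evalz (path_poly 1%g w y) *: Hperm y.
  rewrite -(prod_Hgen (reduced_rev rw)) prod_HgenV -Hperm_prod_path.
  have -> : Hperm (1%g : 'S_n) = 1; last by rewrite mul1r.
  rewrite -(@prod_Hgen [::]) ?big_nil //.
  by rewrite /reduced_expr eqxx cox_length1.
(* The path polynomials witness that an expansion exists, so the default of [xget] is excluded.
   Independence identifies the family chosen. *)
case: xgetP => [r _ /= Er|/(_ [ffun y => evalz (path_poly 1%g w y)]) []] /=.
  by rewrite -[LHS]heval_sum -Er E heval_sum.
by rewrite E; apply: eq_bigr => y _; rewrite ffunE.
Qed.

End HeckeBasis.

(** * Transcendence of t - t^-1 and uniqueness of the R-tilde polynomial *)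

(* Multiplied by t^(deg d), the value at t - t^-1 becomes a polynomial whose
   constant term is the leading coefficient of d up to sign. *)
Lemma transcendental_subV (d : {poly int}) :
  (map_poly intr d).[tfrac - tfrac^-1] = 0 -> d = 0.
Proof.
move=> Hd; apply/eqP/negPn/negP=> d0.
have [N sN] : exists N, size d = N.+1.
  by exists (size d).-1; rewrite prednK // size_poly_gt0.
pose G := \sum_(k < N.+1) (d`_k)%:P * (('X^2 - 1) ^+ k * 'X^(N - k)) : {poly int}.
have G0 : G = 0.
  suff E : tofrac G = (map_poly intr d).[tfrac - tfrac^-1] * tfrac ^+ N.
    by apply/eqP; rewrite -tofrac_eq0 E Hd mul0r.
  rewrite /G rmorph_sum /=.
  rewrite (@horner_coef_wide _ N.+1) ?(leq_trans (size_poly _ _)) ?sN //.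
  rewrite mulr_suml; apply: eq_bigr => k _.
  rewrite coef_map /= -mulrA -[d`_k in LHS]intz rmorph_int rmorphM rmorph_int.
  congr (_ * _); rewrite rmorphM !rmorphXn rmorphB /= rmorphXn rmorph1 /= -/tfrac.
  have -> : tfrac ^+ 2 - 1 = (tfrac - tfrac^-1) * tfrac.
    by rewrite mulrBl mulVf ?tfrac_neq0 // expr2.
  by rewrite exprMn -mulrA -exprD subnKC // -ltnS.
have := congr1 (horner^~ 0) G0; rewrite horner0 /G horner_sum big_ord_recr /=.
rewrite big1 ?add0r => [|k _].
  rewrite subnn expr0 mulr1 hornerM hornerC horner_exp !hornerE => /eqP.
  rewrite mulf_eq0 signr_eq0 orbF => dN.
  by move: d0; rewrite -lead_coef_eq0 lead_coefE sN /= dN.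
by rewrite !hornerM hornerXn expr0n subn_eq0 leqNgt ltn_ord !mulr0.
Qed.

(** Coefficients in the naturals cannot be subtracted, so the difference is formed over the integers
    and evaluated in the fraction field. *)
Lemma evalz_inj : injective evalz.
Proof.
have val_evalz p : val (evalz p) =
    (map_poly intr (map_poly (GRing.natmul (1 : int)) p)).[tfrac - tfrac^-1].
  rewrite /evalz -horner_map -!map_poly_comp /=; congr (_.[_]).
  by apply: eq_map_poly => k /=; rewrite -[laurent_val _]/(val _) !rmorph_nat.
move=> p q /(congr1 val) /eqP; rewrite !val_evalz -subr_eq0 -hornerN -hornerD.
rewrite -rmorphB => /eqP/transcendental_subV/eqP; rewrite subr_eq0 => /eqP E.
apply/polyP=> k; have := congr1 (fun r : {poly int} => r`_k) E.
by rewrite !coef_map /= !natz => -[].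
Qed.

Lemma RtildeE n (w : word n) u v :
  reduced_expr w v -> Rtilde u v = path_poly 1%g w u.
Proof.
move=> rw; rewrite /Rtilde; case: xgetP => [p _ /=|/(_ (path_poly 1%g w u)) []] /=.
  by rewrite (RpolyE _ rw) => /esym /evalz_inj.
exact: RpolyE.
Qed.

(** * Light leaves counted by path polynomials *)

Section LightLeaves.
Variable n : nat.
Implicit Types (u x y : 'S_n) (i j : 'I_n.-1) (w : word n).

Lemma degree_strands w : degree (strands w) = 0%N.
Proof. by elim: w. Qed.

Lemma braid_graph_degree w B w' : braid_graph w B w' -> degree B = 0%N.
Proof. by elim=> [|{}B a i j b _ _ /= ->]; rewrite !degree_strands. Qed.

Lemma size_alt i j m : size (alt i j m) = m.
Proof. by elim: m i j => //= m IH i j; rewrite IH. Qed.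

Lemma wprod_alt i j : i != j ->
  wprod (alt i j (cox_m i j)) = wprod (alt j i (cox_m i j)).
Proof.
wlog ltij : i j / (i < j)%N.
  move=> W ij; case: (ltngtP i j) => [lt|lt|/val_inj E].
  - exact: W.
  - by rewrite cox_mC; symmetry; apply: W; rewrite // eq_sym.
  - by rewrite E eqxx in ij.
move=> _; case: (ltngtP i.+1 j) => [far|lt|Eij]; [|lia|].
  by rewrite cox_m_far //= /pcomp !mul1g (cgen_commute far).
by rewrite cox_m_next //= /pcomp !mul1g (cgen_braid (esym Eij)).
Qed.

Lemma reduced_braid w w' u : braid_equiv w w' -> reduced_expr w u -> reduced_expr w' u.
Proof.
move=> [B H] rw; elim: H => // {}B a i j b ij _.
by rewrite /reduced_expr !wprod_cat !size_cat !size_alt (wprod_alt ij).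
Qed.

(** The invariant is that the top word is reduced. At a descent, Matsumoto's theorem supplies braid
    moves to a reduced word ending in the letter read. *)
Lemma ex_ll_subtree w (D : sgraph n) :
  reduced_expr (top D) (wprod (top D)) -> exists T, ll_subtree w D T.
Proof.
elim: w D => [|i w IH] D rD; first by exists (Leaf D); apply: LLLeaf.
have [Di|Di] := boolP (ascent (wprod (top D)) i).
  have [|T1 H1] := IH (Beside D (Strand i)).
    by rewrite /= cats1 wprod_rcons reduced_rcons_ascent.
  have [|T0 H0] := IH (Beside D (DotDown i)); first by rewrite /= cats0.
  by exists (Node2 D T1 T0); apply: LLUp; rewrite ?ascentE.
have ru := reduced_wordP (pcomp (wprod (top D)) (cgen i)).
set u := reduced_word _ in ru.
have rui : reduced_expr (rcons u i) (wprod (top D)) by rewrite reduced_rconsE Di.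
have [B HB] := Matsumoto rD rui.
have [|T HT] := IH (Stack (Beside (Stack D B) (Strand i)) (Beside (strands u) (Cap i))).
  by rewrite /= cats0 top_strands; case/andP: (ru) => /eqP ->.
by exists (Node1 D T); apply: LLDown HB HT; rewrite descentE.
Qed.

(** Vertices carry no dots and braid moves keep the permutation on top, so the chosen moves affect
    neither degrees nor end points. The branching is then that of [path_poly]. *)
Lemma dRtilde_subtree w (D : sgraph n) T u :
  ll_subtree w D T -> reduced_expr (top D) (wprod (top D)) ->
  dRtilde T u = 'X^(degree D) * path_poly (wprod (top D)) w u.
Proof.
elim=> {w D T} [D|i w D T1 T0|i w D B v T] /=.
- rewrite /dRtilde /light_leaves /= /reduced_expr => /andP[_ sD].
  case: eqP => [<-|_] /=; first by rewrite sD big_seq1 mulr1.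
  by rewrite big_nil mulr0.
- rewrite ascentE => Di _ IH1 _ IH0 rD.
  rewrite /dRtilde /light_leaves /= filter_cat big_cat -/(dRtilde T1 u) -/(dRtilde T0 u).
  rewrite IH1 ?IH0 /= ?cats0 ?cats1 ?wprod_rcons ?reduced_rcons_ascent //.
  by rewrite Di addn0 exprD expr1 mulrDr mulrA.
- rewrite descentE => Di HB _ IH rD.
  have := reduced_braid (ex_intro _ B HB) rD.
  rewrite reduced_rconsE Di /= => rv; have Ev : wprod v = pcomp (wprod (top D)) (cgen i).
    by case/andP: rv => /eqP.
  move: IH; rewrite cats0 top_strands Ev => /(_ rv).
  rewrite -[dRtilde (Node1 D T) u]/(dRtilde T u) => ->.
  by rewrite (braid_graph_degree HB) degree_strands !addn0 (negbTE Di) addr0.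
Qed.

Theorem dRtilde_tree w T u : ll_tree w T -> dRtilde T u = path_poly 1%g w u.
Proof.
move=> /dRtilde_subtree -> /=; first by rewrite expr0 mul1r.
by rewrite /reduced_expr eqxx cox_length1.
Qed.

End LightLeaves.

(** * The word of v_n: return paths to e and reducedness *)

Section CycleWord.
Variable n : nat.
Implicit Types (u x y : 'S_n) (i j : 'I_n.-1) (w : word n).

(** Letters with index above p fix the point p, so a wrong value at p can no longer be repaired.
    This prunes the dead branches. *)
Lemma path_poly_fixed (p : 'I_n) x w y :
  (forall i, i \in w -> p < i)%N -> x p != y p -> path_poly x w y = 0.
Proof.
elim: w x => [|i w IH] x wp xp /=; first by case: (x =P y) xp => [->|//]; rewrite eqxx.
have wp' j : j \in w -> (p < j)%N by move=> jw; apply: wp; rewrite inE jw orbT.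
have ip : (p < i)%N by apply: wp; rewrite mem_head.
rewrite !IH ?mulr0 //; first by case: ifP; rewrite addr0.
rewrite pcompE; have -> // : cgen i p = p.
by apply: val_inj; rewrite /= cgenE; do !case: eqP => /=; lia.
Qed.

(** What remains of the word after k pairs. As m lies in ['I_n.-2], [hi m] and [lo m] are letters,
    and [lo (lo m)] is the point m. *)
Definition vsuffix k : word n :=
  flatten [seq [:: hi m; lo m] | m <- drop k (enum 'I_n.-2)].

Lemma vsuffix_cons (m : 'I_n.-2) : vsuffix m = [:: hi m, lo m & vsuffix m.+1].
Proof.
rewrite /vsuffix (drop_nth m) ?size_enum_ord ?ltn_ord //=.
by rewrite nth_ord_enum.
Qed.

Lemma vsuffix_nil k : (n.-2 <= k)%N -> vsuffix k = [::].
Proof. by move=> ?; rewrite /vsuffix drop_oversize ?size_enum_ord. Qed.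

Lemma mem_vsuffix k i : i \in vsuffix k -> (k <= i)%N.
Proof.
case: (leqP n.-2 k) => [/vsuffix_nil -> //|].
move Ed : (n.-2 - k)%N => d; elim: d k Ed => [|d IH] k Ed lt; first lia.
rewrite (vsuffix_cons (Ordinal lt)) !inE => /or3P[/eqP -> //=|/eqP -> //=|].
case: (leqP n.-2 k.+1) => [/vsuffix_nil -> //|/IH H /H]; lia.
Qed.


Lemma path_vsuffix_fixed (m : 'I_n.-2) x y (p : 'I_n) :
  p = m :> nat -> x p != y p -> path_poly x (vsuffix m.+1) y = 0.
Proof.
move=> pm; apply: path_poly_fixed => i /mem_vsuffix; lia.
Qed.

(** Of the four choices for the pair, those using [lo m] displace the point m for good. What
    survives is two dots, or [hi m] followed by a dot. *)
Lemma path_vsuffix1 (m : 'I_n.-2) :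
  path_poly 1%g (vsuffix m) 1%g
  = 'X^2 * path_poly 1%g (vsuffix m.+1) 1%g
    + 'X * path_poly (cgen (hi m)) (vsuffix m.+1) 1%g.
Proof.
have c1 i : pcomp 1%g (cgen i) = cgen i by rewrite /pcomp mulg1.
have a1 i : ascent 1%g i by rewrite /ascent !perm1 /=.
rewrite vsuffix_cons /= !c1 !a1.
have -> : ascent (cgen (hi m)) (lo m).
  by rewrite /ascent !cgenE /=; do !case: eqP => /=; lia.
rewrite (@path_vsuffix_fixed m (pcomp _ _) _ (lo (lo m))) //; last first.
  by rewrite pcompE perm1 -val_eqE /= !cgenE /=; do !case: eqP => /=; lia.
rewrite (@path_vsuffix_fixed m (cgen (lo m)) _ (lo (lo m))) //; last first.
  by rewrite perm1 -val_eqE /= !cgenE /=; do !case: eqP => /=; lia.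
by rewrite !add0r addrC mulrA.
Qed.

(** The reflection must be undone by this occurrence of [lo m], which forces a dot on [hi m] first:
    otherwise the point m stays displaced. *)
Lemma path_vsuffix_cgen (m : 'I_n.-2) :
  path_poly (cgen (lo m)) (vsuffix m) 1%g
  = 'X * path_poly 1%g (vsuffix m.+1) 1%g.
Proof.
rewrite vsuffix_cons /=.
have -> : ascent (cgen (lo m)) (hi m).
  by rewrite /ascent !cgenE /=; do !case: eqP => /=; lia.
have -> : ascent (cgen (lo m)) (lo m) = false.
  by rewrite /ascent !cgenE /=; do !case: eqP => /=; lia.
have -> : pcomp (cgen (lo m)) (cgen (lo m)) = 1%g by rewrite /pcomp tperm2.
rewrite (@path_vsuffix_fixed m (pcomp (pcomp _ _) _) _ (lo (lo m))) //; last first.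
  by rewrite !pcompE perm1 -val_eqE /= !cgenE /=; do !case: eqP => /=; lia.
rewrite (@path_vsuffix_fixed m (pcomp _ _) _ (lo (lo m))) //; last first.
  by rewrite pcompE perm1 -val_eqE /= !cgenE /=; do !case: eqP => /=; lia.
by case: ascent; rewrite ?mulr0 !addr0 !add0r.
Qed.

Lemma path_vsuffix k : (k <= n.-2)%N ->
  path_poly 1%g (vsuffix k) 1%g = 'X^(n.-2 - k) * fib (n.-2 - k).
Proof.
move Ed : (n.-2 - k)%N => d; elim/ltn_ind: d k Ed => -[|d] IH k Ed lek.
  by rewrite vsuffix_nil /= ?eqxx ?mulr1 //; lia.
have ltk : (k < n.-2)%N by lia.
rewrite (path_vsuffix1 (Ordinal ltk)) (IH d) //=; [|lia..].
(* After the last pair no letter is left to undo the reflection, so that term vanishes. *)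
case: (leqP n.-2 k.+1) => [ge|lt].
  have -> : d = 0%N by lia.
  rewrite vsuffix_nil //=; case: eqP => [E|_]; last by rewrite mulr0 addr0 !mulr1.
  have := congr1 (fun v : 'S_n => val (v (lo (hi (Ordinal ltk))))) E.
  by rewrite perm1 /= cgenE /= eqxx; lia.
(* The first letter of this pair recurs as the second letter of the next one. *)
have -> : hi (Ordinal ltk) = lo (Ordinal lt) by apply: val_inj.
rewrite (path_vsuffix_cgen (Ordinal lt)).
case: d Ed IH => [|d] Ed IH; first lia.
rewrite (IH d) //=; [|lia..].
rewrite -/(fib d.+1); set a := fib d.+1; set b := fib d.
by rewrite !exprS expr0; ring.
Qed.

Lemma vword_vsuffix : vword n = vsuffix 0.
Proof. by rewrite /vsuffix drop0. Qed.

Definition vprefix k : word n :=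
  flatten [seq [:: hi m; lo m] | m <- take k (enum 'I_n.-2)].

Lemma vprefixS (m : 'I_n.-2) :
  vprefix m.+1 = rcons (rcons (vprefix m) (hi m)) (lo m).
Proof.
rewrite /vprefix (take_nth m) ?size_enum_ord ?ltn_ord // nth_ord_enum.
by rewrite map_rcons flatten_rcons -!cats1 -catA.
Qed.

(* On points numbered from 1: the one-line notation 3 4 ... (k+2) 1 2 (k+3) ... n. *)
Lemma vprefixP k : (k <= n.-2)%N ->
  reduced_expr (vprefix k) (wprod (vprefix k)) /\
  forall p : 'I_n, wprod (vprefix k) p =
    (if p < k then p.+2 else if p < k.+2 then p - k else p)%N :> nat.
Proof.
elim: k => [|k IH] lek.
  rewrite /vprefix take0 /= /reduced_expr eqxx cox_length1; split=> // p.
  by rewrite perm1 /=; case: ifP => //; lia.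
have [rk Ek] := IH (ltnW lek); pose m := Ordinal lek.
rewrite (vprefixS m) !wprod_rcons; set u := wprod _ in rk Ek *.
(* Counting from 0, positions k, k+1, k+2 hold 0, 1, k+2. The two letters move k+2 left past 1 and
   then past 0. *)
have a1 : ascent u (hi m) by rewrite /ascent !Ek /=; do !case: ifP; lia.
have a2 : ascent (pcomp u (cgen (hi m))) (lo m).
  by rewrite /ascent !pcompE !Ek !cgenE /=; do !case: ifP; lia.
split=> [|p]; first by do !apply: reduced_rcons_ascent.
rewrite !pcompE !Ek !cgenE /=; do !case: ifP; lia.
Qed.

Lemma reduced_vword : (2 < n)%N -> reduced_expr (vword n) (vperm n).
Proof.
move=> n3; have [r E] := vprefixP (leqnn n.-2).
have Ev : vword n = vprefix n.-2 by rewrite /vprefix take_oversize ?size_enum_ord.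
rewrite Ev; suff <- : wprod (vprefix n.-2) = vperm n by [].
apply/permP=> p; apply: val_inj; rewrite /= E permE /=.
have := ltn_ord p; case: ifP => [lt _|ge pn]; first by rewrite modn_small //; lia.
rewrite ifT; last lia.
have -> : (p.+2 = (p - n.-2) + n)%N by lia.
by rewrite modnDr modn_small //; lia.
Qed.

End CycleWord.


(** * Comparison with the modified Fibonacci polynomials and conclusion *)

Lemma modfibE m : 'X^2 * modfib m = 'X^(m.+1) * fib m.+1.
Proof.
case: m => [|m]; first by rewrite mulr1 expr2.
by rewrite /modfib mulrA -exprD.
Qed.

(** The tree depends on choices of braid moves, so the identities are stated for every tree, and the
    existence clause keeps them from being vacuous. *)
Theorem theorem4p4 (n : nat) (hn : (3 <= n)%N) :
  [/\ reduced_expr (vword n) (vperm n),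
      exists T : dtree n, ll_tree (vword n) T
    & forall T : dtree n, ll_tree (vword n) T ->
      [/\ Rtilde 1%g (vperm n) = dRtilde T 1%g,
          dRtilde T 1%g = 'X^2 * modfib (n - 3)
        & 'X^2 * modfib (n - 3) = 'X^(n - 2) * fib (n - 2)] ].
Proof.
have n_2 : n.-2 = (n - 3).+1 by lia.
have E : path_poly 1%g (vword n) 1%g = 'X^2 * modfib (n - 3).
  by rewrite vword_vsuffix path_vsuffix // subn0 modfibE n_2.
split; first exact: reduced_vword.
  by apply: ex_ll_subtree; rewrite /reduced_expr eqxx cox_length1.
move=> T HT; split.
- by rewrite (RtildeE _ (reduced_vword hn)) (dRtilde_tree _ HT).
- by rewrite (dRtilde_tree _ HT).
- by rewrite modfibE; congr ('X^_ * fib _); lia.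
Qed.
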